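(* Let $n$ and $k$ be positive integers with $n \geq 2k \geq 4$. If $n \leq \frac{8}{3}k$, then $\chi_s(\mathrm{KG}(n,k)) = 2\chi(\mathrm{KG}(n,k)) - 2 = 2n-4k+2$.
   Context: For $n \geq 2k$, the Kneser graph $\mathrm{KG}(n,k)$ is the graph whose vertices are the $k$-element subsets of $[n]=\{1,\ldots,n\}$, two vertices $A,B$ being adjacent iff $A\cap B=\emptyset$; its chromatic number is $\chi(\mathrm{KG}(n,k)) = n-2k+2$. A star-free coloring of a graph $G$ is a proper coloring $c: V(G)\to\mathbb{N}$ such that no path on three vertices is colored with just two consecutive integers (i.e. there is no path $u,v,w$ with $\{c(u),c(v),c(w)\}=\{i,i+1\}$ for some $i$). The star-free chromatic number $\chi_s(G)$ is the minimum positive integer $t$ such that there is a star-free coloring $c: V(G)\to\{1,\ldots,t\}$. *)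

(* Defs.v *)
From HB Require Import structures.
From mathcomp Require Import all_boot.
From mathcomp Require Import boolp.

Set Implicit Arguments.
Unset Strict Implicit.
Unset Printing Implicit Defensive.

Record sgraph := SGraph {
  vertex :> finType;
  adj : rel vertex;
  adj_sym : symmetric adj;
  adj_irrefl : irreflexive adj }.

Section Colorings.
Variable G : sgraph.
Implicit Types (c : G -> nat) (u v w : G).

Definition proper_coloring c : Prop :=
  forall u v, adj u v -> c u <> c v.

Definition path3 u v w : bool :=
  [&& uniq [:: u; v; w], adj u v & adj v w].

(* [=i] between sequences is equality of the underlying sets. *)
Definition star_free_coloring c : Prop :=
  proper_coloring c /\
  (forall u v w i, path3 u v w -> ~ [:: c u; c v; c w] =i [:: i; i.+1]).

Definition colorable (t : nat) : Prop :=
  exists c, proper_coloring c /\ forall v, 1 <= c v <= t.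

Definition star_free_colorable (t : nat) : Prop :=
  exists c, star_free_coloring c /\ forall v, 1 <= c v <= t.

Lemma ex_colorable : exists t, `[< colorable t >].
Proof.
exists #|G|; apply/asboolP; exists (fun v => (enum_rank v).+1).
split=> [u v uv [] /val_inj /enum_rank_inj euv|v]; last exact: ltn_ord.
by rewrite euv adj_irrefl in uv.
Qed.

Lemma ex_star_free_colorable :
  exists t, `[< 0 < t /\ star_free_colorable t >].
Proof.
exists (#|G|.*2.+1); apply/asboolP; split=> //.
exists (fun v => (enum_rank v).*2.+1); split; last first.
  by move=> v; rewrite /= ltnS leq_double ltnW.
split=> [u v uv [] /double_inj /val_inj /enum_rank_inj euv|u v w i _ E].
  by rewrite euv adj_irrefl in uv.
have odd_mem j : j \in [:: i; i.+1] -> odd j.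
  by rewrite -E !inE => /or3P[] /eqP->; rewrite /= odd_double.
have := odd_mem i.+1; rewrite !inE eqxx orbT /= => /(_ isT).
by rewrite odd_mem // !inE eqxx.
Qed.

Definition chromatic_number : nat := ex_minn ex_colorable.

Definition star_free_chromatic_number : nat := ex_minn ex_star_free_colorable.

End Colorings.

Section Kneser.
Variables n k : nat.

Definition ksubset := {A : {set 'I_n} | #|A| == k}.

(* For k > 0 disjoint k-subsets are distinct; the first conjunct only removes
   the loop at the empty set when k = 0. *)
Definition kneser_adj : rel ksubset :=
  fun A B => (A != B) && [disjoint val A & val B].

Lemma kneser_adj_sym : symmetric kneser_adj.
Proof. by move=> A B; rewrite /kneser_adj eq_sym disjoint_sym. Qed.

Lemma kneser_adj_irrefl : irreflexive kneser_adj.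
Proof. by move=> A; rewrite /kneser_adj eqxx. Qed.

Definition kneser : sgraph := SGraph kneser_adj_sym kneser_adj_irrefl.

End Kneser.

(* Main.v *)
Require Import Defs.
From mathcomp Require Import all_boot boolp zify.

(** For the lower bound write d = n - 2k and suppose that KG(n, k) has a star-free
    coloring with at most 2d + 1 colors. Label each nonzero sign vector X = (X+, X-)
    on [n] by its size if |X| <= 2k - 2, and otherwise by a color occurring on k-subsets
    of X+ or X-, signed by the side where it occurs. Ky Fan's lemma yields a maximal
    chain of sign vectors whose labels, sorted by magnitude, alternate in sign; this
    gives d + 2 colors c_1 < ... < c_{d+2}. If |X| > 2k, the color can be chosen "safe":
    no neighboring color occurs on the other side. Indeed a color that is not safe
    belongs to a single k-subset of its side, by star-freeness, so if no color were safe
    then either k + 1 > 2 distinct colors would all be neighbors of a single one, or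
    2k + 2 > 2d + 1 colors would be distinct. Hence two consecutive c_i differ by
    at least 2, except possibly when they label the sign vectors of size 2k - 1 and 2k,
    and c_{d+2} >= 2d + 2. Doubling the colors of a proper coloring gives a star-free
    one, so this also contains Lovasz's bound on the chromatic number. *)

Set Implicit Arguments.
Unset Strict Implicit.
Unset Printing Implicit Defensive.

(** * Parity counting and alternating sequences *)

(** The non-fixed points split into pairs {x, f x}; the induction removes one fixed point or one
    such pair at a time. *)
Lemma odd_count_involution (T : eqType) (f : T -> T) (s : seq T) :
  uniq s -> (forall x, x \in s -> f x \in s) ->
  (forall x, x \in s -> f (f x) = x) ->
  odd (size s) = odd (count (fun x => f x == x) s).
Proof.
move: {2}(size s) (leqnn (size s)) => m.
elim: m s => [|m IHm] [|x s] //= le_sm /andP[xs us] fs fK.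
have [fx|fx] /= := eqVneq (f x) x.
  rewrite (IHm s) // => [y ys|y ys]; last by apply: fK; rewrite inE ys orbT.
  have:= fs y; rewrite !inE ys orbT => /(_ isT) /orP[/eqP fyx|//].
  have:= fK y; rewrite inE ys orbT fyx fx => /(_ isT) xy.
  by rewrite xy ys in xs.
have fxs : f x \in s by have:= fs x; rewrite !inE eqxx (negPf fx) => /(_ isT).
have ffx : f (f x) = x by apply: fK; rewrite inE eqxx.
have p := perm_to_rem fxs.
have sz: size s = (size (rem (f x) s)).+1 by rewrite (perm_size p).
rewrite (permP p) /= ffx eq_sym (negPf fx) add0n sz /= negbK.
apply: IHm; rewrite ?rem_uniq //; first by move: le_sm; rewrite sz => /ltnW.
  move=> y; rewrite mem_rem_uniq // !inE => /andP[yfx ys].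
  have yxs: y \in x :: s by rewrite inE ys orbT.
  rewrite mem_rem_uniq // inE; apply/andP; split.
    apply: contraNneq xs => e; by rewrite -(fK _ yxs) e ffx in ys.
  have := fs _ yxs; rewrite inE => /orP[/eqP e|//].
  by case/eqP: yfx; rewrite -e fK.
by move=> y /mem_rem ys; apply: fK; rewrite inE ys orbT.
Qed.

Definition dropat T (j : nat) (l : seq T) := take j l ++ drop j.+1 l.

Section DropAt.
Variable T : eqType.
Implicit Types (l : seq T) (j : nat).

Lemma map_dropat U (f : T -> U) j l :
  dropat j (map f l) = map f (dropat j l).
Proof. by rewrite /dropat -map_take -map_drop -map_cat. Qed.

Lemma perm_dropat x0 j l :
  j < size l -> perm_eq (nth x0 l j :: dropat j l) l.
Proof.
move=> jl; rewrite -{3}(cat_take_drop j l) (drop_nth x0 jl).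
exact/permPl/(perm_catCA [:: _]).
Qed.

(** Up to order, the list without its entry x is [rem x l], so both sums run over the same multiset
    of values [P (rem x l)]. *)
Lemma sum_dropat_perm (P : seq T -> nat) l l' :
  (forall s s', perm_eq s s' -> P s = P s') -> perm_eq l l' ->
  \sum_(0 <= j < size l) P (dropat j l) = \sum_(0 <= j < size l') P (dropat j l').
Proof.
move=> Pp ll'.
have E s : \sum_(0 <= j < size s) P (dropat j s) = \sum_(x <- s) P (rem x s).
  case: s => [|x0 s']; first by rewrite big_nil big_geq.
  set s := x0 :: s'; rewrite [RHS](big_nth x0); apply: eq_big_nat => j /= js.
  apply: Pp; rewrite -(perm_cons (nth x0 s j)) (permPl (@perm_dropat x0 j s js)).
  exact: perm_to_rem (@mem_nth _ x0 s j js).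
rewrite !E (perm_big _ ll'); apply: eq_bigr => x _; apply: Pp.
have [xl|xl] := boolP (x \in l); last by rewrite !rem_id // -(perm_mem ll').
have xl' : x \in l' by rewrite -(perm_mem ll').
rewrite -(perm_cons x) -(permPl (perm_to_rem xl)) (permPl ll').
exact: perm_to_rem.
Qed.
End DropAt.

Fixpoint alternating (b : bool) (s : seq bool) : bool :=
  if s is x :: s' then (x == b) && alternating (~~ b) s' else true.

Lemma alternating_negb b s : alternating b (map negb s) = alternating (~~ b) s.
Proof. by elim: s b => //= x s IHs b; rewrite IHs; case: x b => [] []. Qed.

(** An alternating sequence has exactly one facet alternating from b: drop its last entry if it
    starts with b, its first entry otherwise. Any other sequence has two equal neighbors; one of
    them must be dropped, and both choices give the same facet, so the count is 0 or 2. *)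
Lemma odd_sum_alternating_dropat b s : s != [::] ->
  odd (\sum_(0 <= j < size s) alternating b (dropat j s)) =
  alternating b s (+) alternating (~~ b) s.
Proof.
elim: s b => // x s IHs b _.
have dropat0 : dropat 0 (x :: s) = s by rewrite /dropat /= drop0.
rewrite big_nat_recl //= dropat0.
case: s IHs {dropat0} => [|y s] IHs; first by rewrite big_geq //; case: x b => [] [].
under eq_bigr => j _ do rewrite /dropat /= -/(dropat j (y :: s)).
set z := y :: s in IHs *.
have -> : \sum_(0 <= i < size z) ((x == b) && alternating (~~ b) (dropat i z)) =
  (x == b) * \sum_(0 <= i < size z) alternating (~~ b) (dropat i z).
  by rewrite big_distrr /=; apply: eq_bigr => i _; case: (x == b); rewrite ?mul1n.
rewrite oddD oddM IHs // negbK !oddb.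
by case: x b => [] [] /=; case: y {IHs} @z => /=;
  case: (alternating true s); case: (alternating false s).
Qed.

(* A signed label is coded by a natural number: half of it is the magnitude, and its
   parity is the sign (odd for [+]). *)
Definition sorted_alternating b (l : seq nat) :=
  alternating b (map odd (sort leq l)).

Lemma sorted_alternating_perm b l l' :
  perm_eq l l' -> sorted_alternating b l = sorted_alternating b l'.
Proof.
move=> ll'; rewrite /sorted_alternating; congr (alternating _ (map _ _)).
by apply/perm_sortP => //; [exact: leq_total|exact: leq_trans|exact: anti_leq].
Qed.

Lemma odd_sum_sorted_alternating b l : l != [::] ->
  odd (\sum_(0 <= j < size l) sorted_alternating b (dropat j l)) =
  sorted_alternating b l (+) sorted_alternating (~~ b) l.
Proof.
move=> l0; set l' := sort leq l.
have ll' : perm_eq l l' by rewrite perm_sym perm_sort.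
have sl' : sorted leq l' by exact: sort_sorted leq_total _.
rewrite (sum_dropat_perm (P := fun l => sorted_alternating b l) _ ll'); last first.
  by move=> s s' /(sorted_alternating_perm b) ->.
rewrite /sorted_alternating -/l'.
rewrite -odd_sum_alternating_dropat; last first.
  by rewrite -size_eq0 size_map -(perm_size ll') size_eq0.
rewrite size_map; congr odd; apply: eq_big_nat => j _.
rewrite map_dropat (sorted_sort leq_trans) //.
apply: (subseq_sorted leq_trans) sl'.
rewrite /dropat -{3}(cat_take_drop j l') cat_subseq // -add1n -drop_drop.
exact: drop_subseq.
Qed.

Definition antipode (x : nat) := if odd x then x.-1 else x.+1.

(** [antipode] only swaps 2m with 2m + 1. As no such pair occurs in l, it is monotone on l and
    commutes with sorting. *)
Lemma sorted_alternating_antipode b l :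
  {in l &, forall x y, y != antipode x} ->
  sorted_alternating b (map antipode l) = sorted_alternating (~~ b) l.
Proof.
move=> nc; rewrite /sorted_alternating -alternating_negb -map_comp.
suff -> : sort leq (map antipode l) = map antipode (sort leq l).
  rewrite -map_comp; congr alternating; apply: eq_map => x /=.
  by rewrite /antipode; case: ifP => /=; lia.
apply: (sorted_eq leq_trans anti_leq); first exact: sort_sorted leq_total _.
  have: sorted leq (sort leq l) by exact: sort_sorted leq_total _.
  have: all (mem l) (sort leq l) by apply/allP => x; rewrite mem_sort.
  move=> al sl; rewrite sorted_map.
  apply: (@sub_in_sorted _ (mem l) leq _ _ _ al sl) => x y xl yl /= xy.
  have := nc x y xl yl; have := nc y x yl xl.
  by rewrite /antipode; do 2!case: ifP; lia.
by rewrite (perm_trans (y := map antipode l)) // ?perm_sort // perm_map // perm_sym perm_sort.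
Qed.

(** * Signed permutations as maximal chains of sign vectors *)

Implicit Types s : seq (nat * bool).

Definition negate s := [seq (x.1, ~~ x.2) | x <- s].

Lemma negateK : involutive negate.
Proof. by move=> s; rewrite /negate -map_comp map_id_in //= => -[x b] _ /=; rewrite negbK. Qed.

Lemma mem_negate x b s : ((x, b) \in negate s) = ((x, ~~ b) \in s).
Proof.
apply/mapP/idP => [[[y c] yc [-> ->]]|xb]; first by rewrite negbK.
by exists (x, ~~ b); rewrite //= negbK.
Qed.

Lemma unzip1_negate s : unzip1 (negate s) = unzip1 s.
Proof. by rewrite /unzip1 /negate -map_comp. Qed.

(** These are the facets of the barycentric subdivision of the boundary of the m-dimensional
    cross-polytope. *)
Definition signed_perms m :=
  [seq zip p (b : seq bool) | p <- permutations (iota 0 m), b <- map val (enum {: m.-tuple bool})].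

Lemma mem_signed_perms m s :
  (s \in signed_perms m) = perm_eq (unzip1 s) (iota 0 m).
Proof.
apply/allpairsP/idP => [[[p b]] /= [pm]|s_m].
  case/mapP => t _ -> ->; rewrite mem_permutations in pm.
  by rewrite unzip1_zip // size_tuple (perm_size pm) size_iota.
exists (unzip1 s, unzip2 s); rewrite /= zip_unzip mem_permutations.
split=> //; have sz : size (unzip2 s) == m.
  by rewrite size_map -(size_map fst) (perm_size s_m) size_iota.
by apply/mapP; exists (Tuple sz); rewrite // mem_enum.
Qed.

Lemma signed_perms_uniq m : uniq (signed_perms m).
Proof.
apply: allpairs_uniq; rewrite ?permutations_uniq //.
  by rewrite map_inj_uniq ?enum_uniq //; exact: val_inj.
move=> _ _ /allpairsP[[p b] /= [pm /mapP[t _ ->] ->]] /allpairsP[[q c] /= [qm /mapP[u _ ->] ->]].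
move: pm qm; rewrite !mem_permutations => /perm_size + /perm_size.
rewrite size_iota /= => pm qm /(congr1 (fun s => (unzip1 s, unzip2 s))).
by rewrite !unzip1_zip ?unzip2_zip ?size_tuple ?pm ?qm.
Qed.

(* A list of signed elements encodes the maximal chain of its prefixes; [s] and
   [pivot j s] are the two chains that differ at most in the member of size [j.+1]. *)
Fixpoint pivot j s :=
  match j, s with
  | 0, [:: x] => [:: (x.1, ~~ x.2)]
  | 0, x :: y :: s' => y :: x :: s'
  | j'.+1, x :: s' => x :: pivot j' s'
  | _, [::] => [::]
  end.

Lemma pivotK j : involutive (pivot j).
Proof.
elim: j => [|j IHj] [|x s] //=; last by rewrite IHj.
by case: s => //=; case: x => x b /=; rewrite negbK.
Qed.

Lemma pivot_neq j s : j < size s -> uniq (unzip1 s) -> pivot j s != s.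
Proof.
elim: j s => [|j IHj] [|x s] //=.
  case: s => [|y s] _ /=; first by case: x => x [] _; rewrite eqseq_cons andbT xpair_eqE /= andbF.
  by rewrite inE negb_or; case/andP => /andP[xy _] _; apply: contraNneq xy => -[->].
by move=> js /andP[_ us]; apply: contraNneq (IHj s js us) => -[->].
Qed.

Lemma unzip1_pivot j s : perm_eq (unzip1 (pivot j s)) (unzip1 s).
Proof.
elim: j s => [|j IHj] [|x s] //=; last by rewrite perm_cons.
by case: s => [|y s] //=; apply/permPl/(perm_catCA [:: _] [:: _]).
Qed.

Lemma pivot_perm j s : j.+1 < size s -> perm_eq (pivot j s) s.
Proof.
elim: j s => [|j IHj] [|x s] //= js; last by rewrite perm_cons IHj.
by case: s js => [|y s] //= _; apply/permPl/(perm_catCA [:: _] [:: _]).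
Qed.

Lemma take_pivot i j s : i < size s -> i != j ->
  perm_eq (take i.+1 (pivot j s)) (take i.+1 s).
Proof.
elim: j i s => [|j IHj] [|i] [|x s] //=; rewrite ?take0 //.
  case: s => //= y s _ _; apply/permPl/(perm_catCA [:: _] [:: _]).
by move=> js ij; rewrite perm_cons; exact: IHj.
Qed.

Lemma pivot_rcons s x : pivot (size s) (rcons s x) = rcons s (x.1, ~~ x.2).
Proof. by elim: s => //= y s ->. Qed.

Definition chain_labels (lam : seq (nat * bool) -> nat) s :=
  [seq lam (take i.+1 s) | i <- iota 0 (size s)].

Lemma dropat_chain_labels_pivot lam j s :
  (forall u v, perm_eq u v -> lam u = lam v) ->
  dropat j (chain_labels lam (pivot j s)) = dropat j (chain_labels lam s).
Proof.
move=> lamP; rewrite /chain_labels -(size_map fst (pivot _ _)).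
rewrite (perm_size (unzip1_pivot j s)) size_map !map_dropat.
apply/eq_in_map => i; rewrite /dropat take_iota drop_iota mem_cat !mem_iota => ij.
by apply/lamP/take_pivot; lia.
Qed.

Lemma dropat_chain_labels_rcons lam s x :
  dropat (size s) (chain_labels lam (rcons s x)) = chain_labels lam s.
Proof.
rewrite /chain_labels map_dropat size_rcons /dropat take_iota drop_oversize ?size_iota //.
rewrite cats0; have /minn_idPl -> := leqnSn (size s).
by apply/eq_in_map => i; rewrite mem_iota => /andP[_ i_s]; rewrite -cats1 takel_cat.
Qed.

Lemma rcons_signed_perms m s b :
  (rcons s (m, b) \in signed_perms m.+1) = (s \in signed_perms m).
Proof.
rewrite !mem_signed_perms /unzip1 map_rcons -addn1 iotaD cats1 /= add0n.
by rewrite perm_rcons perm_sym perm_rcons perm_cons perm_sym.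
Qed.

Lemma unzip1_uniq_inj s x b c :
  uniq (unzip1 s) -> (x, b) \in s -> (x, c) \in s -> b = c.
Proof.
elim: s => //= -[y e] s IHs /= /andP[ys us].
have sub z : (x, z) \in s -> y != x.
  by move=> xs; apply: contraNneq ys => ->; apply/mapP; exists (x, z).
rewrite !inE !xpair_eqE => /orP[/andP[/eqP xy /eqP->]|xb] /orP[/andP[/eqP xy' /eqP->]|xc] //.
- by have := sub _ xc; rewrite eq_sym xy eqxx.
- by have := sub _ xb; rewrite eq_sym xy' eqxx.
exact: IHs.
Qed.

(** * Ky Fan's lemma *)

Section Fan.
Variables (n : nat) (lam : seq (nat * bool) -> nat).
(** A sign vector is listed by its nonzero entries in any order. The hypotheses below make [lam] a
    function of the vector, antipodal, and without complementary edges. *)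
Definition signed_set s := uniq (unzip1 s) && all (gtn n) (unzip1 s).
Hypothesis lam_perm : forall s s', perm_eq s s' -> lam s = lam s'.
Hypothesis lam_negate : forall s, s != [::] -> signed_set s ->
  lam (negate s) = antipode (lam s).
Hypothesis lam_prefix : forall s i, signed_set s -> 0 < i < size s ->
  lam (take i s) != antipode (lam s).

Let labels := chain_labels lam.

Lemma antipodeK : involutive antipode.
Proof. by move=> x; rewrite /antipode; do 2!case: ifP; lia. Qed.

Lemma signed_perms_set m s : m <= n -> s \in signed_perms m -> signed_set s.
Proof.
move=> mn; rewrite mem_signed_perms /signed_set => s_m.
rewrite (perm_uniq s_m) iota_uniq (perm_all _ s_m); apply/allP => i.
by rewrite mem_iota /= => /leq_trans->.
Qed.

Lemma signed_set_take i s : signed_set s -> signed_set (take i s).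
Proof.
case/andP => us /allP sn; rewrite /signed_set /unzip1 map_take take_uniq //=.
by apply/allP => x /mem_take; exact: sn.
Qed.

Lemma size_signed_perms m s : s \in signed_perms m -> size s = m.
Proof.
by rewrite mem_signed_perms => /perm_size; rewrite size_map size_iota.
Qed.

Lemma labels_noncomplementary s : signed_set s ->
  {in labels s &, forall x y, y != antipode x}.
Proof.
move=> s_n _ _ /mapP[i + ->] /mapP[j + ->]; rewrite !mem_iota !add0n => /andP[_ si] /andP[_ sj].
have key a b : a < b -> b < size s -> lam (take a.+1 s) != antipode (lam (take b.+1 s)).
  move=> ab bs; rewrite -(@take_takel _ a.+1 b.+1) //; last exact: ltnW.
  by apply: lam_prefix; rewrite ?signed_set_take // size_takel.
have [ij|ij|->] := ltngtP i j; last by rewrite /antipode; case: ifP; lia.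
  by rewrite -(inj_eq (can_inj antipodeK)) antipodeK eq_sym key.
exact: key.
Qed.

Lemma labels_negate s : signed_set s ->
  labels (negate s) = map antipode (labels s).
Proof.
move=> s_n; rewrite /labels /chain_labels size_map -map_comp.
apply/eq_in_map => i; rewrite mem_iota /= => i_s.
rewrite /negate -map_take -lam_negate ?signed_set_take //.
by case: s i_s {s_n}.
Qed.

Lemma mem_negate_signed_perms m s :
  (negate s \in signed_perms m) = (s \in signed_perms m).
Proof. by rewrite !mem_signed_perms unzip1_negate. Qed.

Lemma mem_signed_perms_top m s b : s \in signed_perms m.+1 ->
  ((m, ~~ b) \in s) = ((m, b) \notin s).
Proof.
rewrite mem_signed_perms => s_m.
have us : uniq (unzip1 s) by rewrite (perm_uniq s_m) iota_uniq.
have : m \in unzip1 s by rewrite (perm_mem s_m) mem_iota /=.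
case/mapP => -[y c] yc /= my; rewrite -{}my in yc.
have E e : ((m, e) \in s) = (e == c).
  by apply/idP/eqP => [me|->//]; exact: unzip1_uniq_inj us me yc.
by rewrite !E; case: b c {yc E} => [] [].
Qed.

(* Count the pairs of a maximal chain on [0..m] avoiding [(m, false)] and a positive
   alternating facet of it. By [pivot] all pairs cancel except those whose facet is a
   maximal chain on [0..m-1]; on the other hand a chain has an odd number of such facets
   iff it is alternating, and negative alternating chains are exchanged by [negate] with
   the positive ones that contain [(m, false)]. *)
Lemma odd_count_sorted_alternating m : m <= n ->
  odd (count (fun s => sorted_alternating true (labels s)) (signed_perms m)).
Proof.
elim: m => [_|m IHm mn].
  have -> : signed_perms 0 = [:: [::]].
    apply: perm_small_eq => //.
    apply: uniq_perm; rewrite ?signed_perms_uniq // => s.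
    by rewrite mem_signed_perms inE; case: s => // x s; apply/idP => /perm_size.
  by [].
set SP := signed_perms m.+1.
set pos := (fun s => sorted_alternating true (labels s)).
set neg := (fun s => sorted_alternating false (labels s)).
set U := [seq s <- SP | (m, true) \in s].
have US s : s \in U -> s \in SP by rewrite mem_filter => /andP[].
have uU : uniq U by rewrite filter_uniq ?signed_perms_uniq.
pose P (x : seq (nat * bool) * nat) := sorted_alternating true (dropat x.2 (labels x.1)).
(* Pivoting at m a chain that ends in (m, true) would flip the sign of m and leave U; exactly these
   pairs are kept fixed. *)
pose f (x : seq (nat * bool) * nat) :=
  if (x.2 == m) && (last (0, false) x.1 == (m, true)) then x else (pivot x.2 x.1, x.2).
pose PL := [seq (s, j) | s <- U, j <- iota 0 m.+1].
have szU s : s \in U -> size s = m.+1 by move/US/size_signed_perms.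
have sum1 : count P PL = \sum_(s <- U) \sum_(0 <= j < size (labels s)) P (s, j).
  rewrite -sum1_count big_mkcond big_allpairs; apply: eq_big_seq => s /szU sz.
  rewrite size_map size_iota sz /index_iota subn0; apply: eq_bigr => j _.
  by case: (P _).
have step1 : odd (count pos U + count neg U) = odd (count P PL).
  have countE Q : count Q U = \sum_(s <- U) Q s.
    by rewrite -sum1_count big_mkcond; apply: eq_bigr => s _; case: (Q s).
  rewrite sum1 !countE -big_split !(big_morph odd oddD (erefl : odd 0 = false)).
  apply: eq_big_seq => s sU; rewrite odd_sum_sorted_alternating.
    by rewrite oddD /pos /neg; do 2!case: sorted_alternating.
  by rewrite -size_eq0 size_map size_iota (szU s sU).
have f_fixed s j : s \in U -> j < m.+1 ->
    (f (s, j) == (s, j)) = (j == m) && (last (0, false) s == (m, true)).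
  move=> sU jm; rewrite /f /=; case: ifP => _; first exact: eqxx.
  rewrite xpair_eqE (negPf (pivot_neq _ _)) ?(szU s sU) //.
  have := US _ sU; rewrite mem_signed_perms => /perm_uniq->; exact: iota_uniq.
(* Appending (m, true) matches the positive alternating chains on [0..m-1] with the fixed pairs. *)
have sum2 : count (fun x => f x == x) [seq x <- PL | P x] = count pos (signed_perms m).
  rewrite -!size_filter -filter_predI -(size_map (fun s => (rcons s (m, true), m))).
  apply/perm_size/uniq_perm.
  - by rewrite filter_uniq // allpairs_uniq ?iota_uniq // => -[? ?] [? ?] _ _ [-> ->].
  - rewrite map_inj_uniq ?filter_uniq ?signed_perms_uniq // => s s' [].
    by move/rcons_inj => [].
  move=> -[s j]; apply/idP/mapP => [|[s']].
    rewrite mem_filter /= => /andP[/andP[fx Px] /allpairsP[[s' j'] /= [sU jm [? ?]]]]; subst s' j'.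
    rewrite -[0 :: _]/(iota 0 m.+1) mem_iota /= in jm.
    move: fx; rewrite f_fixed // => /andP[/eqP ? /eqP ls]; subst j.
    move: sU (szU _ sU) Px ls; case/lastP: s => // s x sU; rewrite size_rcons => -[sz] Px.
    rewrite last_rcons => ?; subst x; exists s => //.
    rewrite mem_filter -(rcons_signed_perms _ _ true) US // andbT.
    by move: Px; rewrite /P /= -sz dropat_chain_labels_rcons.
  rewrite mem_filter => /andP[ps s'm] [-> ->].
  have sU : rcons s' (m, true) \in U.
    by rewrite mem_filter rcons_signed_perms s'm mem_rcons inE eqxx.
  rewrite mem_filter /= f_fixed // last_rcons !eqxx /=.
  have -> : P (rcons s' (m, true), m).
    by move: ps; rewrite /pos /labels -(dropat_chain_labels_rcons _ s' (m, true))
      (size_signed_perms s'm).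
  by apply/allpairsP; exists (rcons s' (m, true), m); split=> //; rewrite mem_iota add0n leqnn.
have step2 : count pos SP = count pos U + count neg U.
  have -> : count pos SP = count pos U + count pos [seq s <- SP | (m, true) \notin s].
    by rewrite -count_cat; apply/permP; rewrite perm_sym perm_filterC.
  congr addn.
  have /permP-> : perm_eq [seq s <- SP | (m, true) \notin s] (map negate U).
    apply: uniq_perm; rewrite ?filter_uniq ?signed_perms_uniq //.
      by rewrite (map_inj_uniq (can_inj negateK)).
    move=> s; rewrite -{2}(negateK s) (mem_map (can_inj negateK)) !mem_filter.
    rewrite mem_negate_signed_perms mem_negate.
    by have [sSP|] := boolP (s \in SP); rewrite ?andbF // (mem_signed_perms_top true sSP).
  rewrite count_map; apply: eq_in_count => s /US /(signed_perms_set mn) s_n /=.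
  rewrite /pos labels_negate // sorted_alternating_antipode //.
  exact: labels_noncomplementary.
have PL_uniq : uniq PL.
  by rewrite allpairs_uniq ?iota_uniq // => -[? ?] [? ?] _ _ [-> ->].
have mem_PL s j : ((s, j) \in PL) = (s \in U) && (j < m.+1).
  apply/allpairsP/andP => [[[s' j'] [sU + [-> ->]]]|[sU jm]].
    by rewrite mem_iota => /andP[].
  by exists (s, j); rewrite mem_iota.
(* Since (m, false) is not in s, a last entry other than (m, true) belongs to another element, so
   flipping its sign stays in U. *)
have mem_pivot s : s \in U -> last (0, false) s != (m, true) ->
    pivot m s \in U /\ last (0, false) (pivot m s) != (m, true).
  move=> sU; have := szU s sU; have sSP := US s sU; have mf := mem_signed_perms_top true sSP.
  move: sU mf sSP; rewrite !mem_filter; case/lastP: s => // s [y c].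
  rewrite size_rcons last_rcons => /andP[ms _] mf sSP [sz] mx.
  have pE := pivot_rcons s (y, c); rewrite sz /= in pE; rewrite pE last_rcons; split.
    apply/andP; split.
      move: ms; rewrite !mem_rcons !inE => /orP[/eqP e|->]; last by rewrite orbT.
      by rewrite e eqxx in mx.
    by rewrite -pE mem_signed_perms (permPl (unzip1_pivot _ _)) -mem_signed_perms.
  move: mf; rewrite ms mem_rcons inE.
  case: c {mx sSP ms pE} => //= [_|mf]; first by apply/eqP => -[].
  by apply: contraFneq mf => -[->]; rewrite eqxx.
rewrite step2 step1 -size_filter (@odd_count_involution _ f) ?sum2 ?IHm ?(ltnW mn) //.
- by rewrite filter_uniq.
- move=> -[s j]; rewrite !mem_filter mem_PL => /andP[Psj /andP[sU jm]].
  rewrite /f /=; case: ifP => [|last_s]; first by rewrite Psj mem_PL sU.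
  rewrite mem_PL jm andbT /P /= /labels dropat_chain_labels_pivot // -/(P (s, j)) Psj /=.
  move: jm; rewrite ltnS leq_eqVlt => /orP[/eqP jm|jm].
    by rewrite jm (mem_pivot _ sU _).1 //; move: last_s; rewrite jm eqxx => /negbT.
  have ps : perm_eq (pivot j s) s by rewrite pivot_perm // szU.
  move: sU; rewrite !mem_filter (perm_mem ps) => /andP[-> /=].
  by rewrite !mem_signed_perms (permPl (unzip1_pivot _ _)).
move=> -[s j]; rewrite mem_filter mem_PL => /andP[_ /andP[sU jm]].
rewrite {2}/f /=; case: ifP => [|last_s]; first by rewrite /f /= => ->.
rewrite /f /= pivotK; case: ifP => // /andP[/eqP ej]; subst j.
rewrite eqxx /= in last_s.
by case: (mem_pivot s sU (negbT last_s)) => _ /negPf->.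
Qed.

Theorem fan_alternating_chain : exists s, perm_eq (unzip1 s) (iota 0 n) /\
  sorted_alternating true (labels s).
Proof.
have : has (fun s => sorted_alternating true (labels s)) (signed_perms n).
  by rewrite has_count; case: count (odd_count_sorted_alternating (leqnn n)).
by case/hasP => s; rewrite mem_signed_perms; exists s.
Qed.
End Fan.

(** * Star-free colorings of Kneser graphs and safe colors *)

(** Otherwise u, v, w would be a path colored with two consecutive integers. *)
Lemma star_free_neighbor_inj (G : sgraph) (c : G -> nat) (u v w : G) :
  star_free_coloring c -> adj u v -> adj v w -> c u = c w ->
  c v = (c u).+1 \/ c u = (c v).+1 -> u = w.
Proof.
move=> [_ sf] uv vw cuw cuv; apply/eqP/negPn/negP => uw.
have p3 : path3 u v w.
  rewrite /path3 uv vw /= !inE negb_or uw !andbT; apply/andP; split.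
    by apply: contraTN uv => /eqP->; rewrite adj_irrefl.
  by apply: contraTN vw => /eqP->; rewrite adj_irrefl.
by case: cuv => e; [apply: (sf _ _ _ (c u) p3)|apply: (sf _ _ _ (c v) p3)] => x;
  rewrite !inE -cuw e; case: eqP; case: eqP; lia.
Qed.

Section KneserColoring.
Variables (n k : nat).
Implicit Types (A B : kneser n k) (S T : {set 'I_n}).

Lemma kneser_adjE S T A B : 0 < k -> [disjoint S & T] ->
  val A \subset S -> val B \subset T -> adj A B.
Proof.
move=> k0 dST AS BT.
have dAB : [disjoint val A & val B] by exact: disjointWl AS (disjointWr BT dST).
apply/andP; split=> //; apply: contraTneq dAB => ->.
rewrite -setI_eq0 setIid -card_gt0; by rewrite (eqP (valP B)).
Qed.

Lemma card_ksubsets S : #|[set A : kneser n k | val A \subset S]| = 'C(#|S|, k).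
Proof.
rewrite -cards_draws -(card_imset _ val_inj); apply: eq_card => B.
apply/imsetP/idP => [[A + ->]|]; rewrite !inE.
  by move=> ->; exact: (valP A).
by case/andP => BS Bk; exists (Sub B Bk); rewrite ?inE SubK.
Qed.

Lemma ksubset_exists S : k <= #|S| -> exists A : kneser n k, val A \subset S.
Proof.
rewrite -bin_gt0 -card_ksubsets card_gt0 => /set0Pn[A].
by rewrite inE; exists A.
Qed.

Variables (t : nat) (c : kneser n k -> nat).
Hypotheses (k_gt1 : 1 < k) (c_sf : star_free_coloring c) (c_t : forall A, 1 <= c A <= t).

Definition has_color S a := [exists A : kneser n k, (val A \subset S) && (c A == a)].

Lemma has_colorP S a :
  reflect (exists2 A : kneser n k, val A \subset S & c A = a) (has_color S a).
Proof.
apply: (iffP existsP) => [[A /andP[AS /eqP ca]]|[A AS ca]]; first by exists A.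
by exists A; rewrite AS ca eqxx.
Qed.

Lemma has_color_bound S a : has_color S a -> 1 <= a <= t.
Proof. by case/has_colorP => A _ <-; exact: c_t. Qed.

Lemma has_color_sub S T a : S \subset T -> has_color S a -> has_color T a.
Proof.
by move=> ST /has_colorP[A AS ca]; apply/has_colorP; exists A; rewrite ?(subset_trans AS).
Qed.

Lemma has_color_disjoint S T a : [disjoint S & T] -> has_color S a -> ~~ has_color T a.
Proof.
move=> dST /has_colorP[A AS ca]; apply/has_colorP => -[B BT cb].
by apply: (c_sf.1 A B); rewrite ?ca ?cb // (kneser_adjE _ dST) // ltnW.
Qed.

Definition safe S T a :=
  [&& has_color S a, ~~ has_color T a.+1 & ~~ has_color T a.-1].

Lemma not_safe S T A : val A \subset S -> ~~ safe S T (c A) ->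
  exists2 B : kneser n k, val B \subset T & c B = (c A).+1 \/ c A = (c B).+1.
Proof.
move=> AS; have cA : has_color S (c A) by apply/has_colorP; exists A.
have := c_t A.
rewrite /safe cA /= -negb_or negbK => c0 /orP[] /has_colorP[B BT cB]; exists B => //; lia.
Qed.

(** An unsafe color on S has a neighboring color on some B inside T, and B is adjacent to every
    k-subset of S with that color; star-freeness leaves only one. *)
Lemma unsafe_inj S T : [disjoint S & T] -> (forall a, ~~ safe S T a) ->
  {in [set A : kneser n k | val A \subset S] &, injective c}.
Proof.
move=> dST us A A'; rewrite !inE => AS A'S cAA'.
have [B BT cB] := not_safe AS (us _).
apply: (star_free_neighbor_inj c_sf (v := B)) cB => //.
  by apply: (kneser_adjE _ dST) => //; exact: ltnW.
by rewrite adj_sym; apply: (kneser_adjE _ dST) => //; exact: ltnW.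
Qed.

Lemma safe_exists S T : t < 2 * k + 2 -> [disjoint S & T] -> 2 * k < #|S| + #|T| ->
  exists a : nat, safe S T a || safe T S a.
Proof.
move=> tk; wlog le_TS : S T / #|T| <= #|S| => [wl|] dST big.
  have [/wl|/ltnW/wl] := leqP #|T| #|S|; first by apply.
  rewrite disjoint_sym addnC => /(_ dST big) [a].
  by rewrite orbC; exists a.
have kS : k < #|S| by lia.
case: (pickP [pred a : 'I_t.+1 | safe S T a || safe T S a]) => [a sa|noa]; first by exists (val a).
have nos (a : nat) : safe S T a || safe T S a = false.
  apply/negP => sa; have at1 : a < t.+1.
    by case/orP: sa => /andP[/has_color_bound /andP[_ ?] _].
  by have := noa (Ordinal at1); rewrite /= sa.
have usS a : ~~ safe S T a by have /norP[] := negbT (nos a).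
have usT a : ~~ safe T S a by have /norP[] := negbT (nos a).
have injS := unsafe_inj dST usS.
have injT : {in [set A : kneser n k | val A \subset T] &, injective c}.
  by apply: (unsafe_inj (T := S)); rewrite // disjoint_sym.
set FS := [set A : kneser n k | val A \subset S] in injS.
set FT := [set A : kneser n k | val A \subset T] in injT.
have cardS : k.+1 <= #|FS|.
  rewrite card_ksubsets; apply: leq_trans (leq_bin2l k kS).
  by rewrite binSn.
have uS : uniq (map c (enum FS)).
  by rewrite map_inj_in_uniq ?enum_uniq // => A A'; rewrite !mem_enum; exact: injS.
have uT : uniq (map c (enum FT)).
  by rewrite map_inj_in_uniq ?enum_uniq // => A A'; rewrite !mem_enum; exact: injT.
(* If T has at most k elements, it contains a single k-subset B, and the k + 1 colors on S all lie
   next to [c B]. Otherwise each side carries k + 1 colors, with none in common. *)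
have [Tk|kT] := leqP #|T| k.
  have [B0 B0S] := ksubset_exists (ltnW kS).
  have [B BT _] := not_safe B0S (usS _).
  have sub : {subset map c (enum FS) <= [:: (c B).+1; (c B).-1]}.
    move=> _ /mapP[A + ->]; rewrite mem_enum inE => AS.
    have [B' B'T cB'] := not_safe AS (usS _).
    have /card_le1_eqP FT1 : #|FT| <= 1.
      by rewrite card_ksubsets (leq_trans (leq_bin2l k Tk)) // binn.
    have BB' : B' = B by apply: FT1; rewrite inE.
    by subst B'; rewrite !inE; case: cB' => ->; rewrite /= eqxx ?orbT.
  have := uniq_leq_size uS sub; rewrite size_map -cardE => /(leq_trans cardS) /=; lia.
have cardT : k.+1 <= #|FT|.
  by rewrite card_ksubsets; apply: leq_trans (leq_bin2l k kT); rewrite binSn.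
have uST : uniq (map c (enum FS) ++ map c (enum FT)).
  rewrite cat_uniq uS uT /= andbT; apply/hasPn => _ /mapP[B + ->].
  rewrite mem_enum inE => BT; apply/mapP => -[A +]; rewrite mem_enum inE => AS cAB.
  by apply: (c_sf.1 A B) => //; apply: (kneser_adjE _ dST) => //; exact: ltnW.
have sub : {subset map c (enum FS) ++ map c (enum FT) <= iota 1 t}.
  by move=> a; rewrite mem_cat => /orP[] /mapP[A _ ->]; rewrite mem_iota; have := c_t A; lia.
have := uniq_leq_size uST sub.
rewrite size_cat !size_map -!cardE size_iota => /(leq_trans (leq_add cardS cardT)); lia.
Qed.

(** * The labelling of sign vectors *)

Definition side b s : {set 'I_n} := [set i : 'I_n | (val i, b) \in s].

Lemma side_negate b s : side b (negate s) = side (~~ b) s.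
Proof. by apply/setP => i; rewrite !inE mem_negate. Qed.

Lemma side_perm b s s' : perm_eq s s' -> side b s = side b s'.
Proof. by move=> p; apply/setP => i; rewrite !inE (perm_mem p). Qed.

Lemma side_take b i s : side b (take i s) \subset side b s.
Proof. by apply/subsetP => x; rewrite !inE => /mem_take. Qed.

Lemma side_disjoint b s : signed_set n s -> [disjoint side b s & side (~~ b) s].
Proof.
case/andP => us _; rewrite -setI_eq0; apply/eqP/setP => i; rewrite !inE.
by apply/andP => -[sb snb]; have := unzip1_uniq_inj us sb snb; case: b {sb snb}.
Qed.

Lemma card_side b s : signed_set n s -> #|side b s| + #|side (~~ b) s| = size s.
Proof.
move=> sn; have := side_disjoint b sn; case/andP: sn => us /allP lt_n.
rewrite -setI_eq0 => /eqP d0; rewrite -[_ + _]subn0 -(cards0 'I_n) -d0 -cardsU.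
rewrite cardE -(size_map val) -(size_map fst s); apply/perm_size/uniq_perm => //.
  by rewrite (map_inj_uniq val_inj) enum_uniq.
move=> x; apply/mapP/mapP => [[i + ->]|[[y e] ys /= ->]].
  by rewrite mem_enum !inE => /orP[] is_; eexists; [exact: is_| |exact: is_|].
have yn : y < n by apply: lt_n; apply/mapP; exists (y, e).
exists (Ordinal yn) => //; rewrite mem_enum !inE /=.
by case: b e ys {d0} => [] [] ->; rewrite ?orbT.
Qed.

Definition good s a := has (fun b =>
  if 2 * k < size s then safe (side b s) (side (~~ b) s) a
  else has_color (side b s) a) [:: true; false].

(** The least good color, hence invariant under negation. The default 0 is never reached on sign
    vectors of size above 2k - 2. *)
Definition color s := head 0 [seq a <- iota 1 t | good s a].

(* Sizes are doubled and colors shifted so that, in a chain, magnitudes of opposite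
   sign differ by at least 2 with the single exception in [label_gap]. *)
Definition magnitude s :=
  if size s <= 2 * k - 2 then 2 * size s else 4 * k - 3 + color s.

(** A small vector takes the sign of its least nonzero entry. For a large one, the color occurs on
    exactly one side, because k-subsets of opposite sides are adjacent. *)
Definition sign s :=
  if size s <= 2 * k - 2 then (find (mem (unzip1 s)) (iota 0 n), true) \in s
  else has_color (side true s) (color s).

Definition label s := sign s + (magnitude s).*2.

Lemma label_half s : (label s)./2 = magnitude s.
Proof. by rewrite /label; case: sign => /=; lia. Qed.

Lemma odd_label s : odd (label s) = sign s.
Proof. by rewrite /label oddD odd_double addbF oddb. Qed.

Lemma label_perm s s' : perm_eq s s' -> label s = label s'.
Proof.
move=> p; have gp : good s =1 good s'.
  by move=> a; rewrite /good /= (perm_size p) !(side_perm _ p).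
have fE : find (mem (unzip1 s)) (iota 0 n) = find (mem (unzip1 s')) (iota 0 n).
  by apply: eq_find => x /=; apply: perm_mem; exact: perm_map.
by rewrite /label /sign /magnitude /color fE (eq_filter gp) (perm_size p)
  (perm_mem p) (side_perm _ p).
Qed.

Lemma good_negate s : good (negate s) =1 good s.
Proof.
by move=> a; rewrite /good /= size_map !side_negate /= !orbF orbC.
Qed.

Hypothesis t_lt : t < 2 * k + 2.

(** Above size 2k a safe color exists; for sizes 2k - 1 and 2k one side has at least k elements by
    pigeonhole. *)
Lemma good_color s : signed_set n s -> 2 * k - 2 < size s -> good s (color s).
Proof.
move=> sn big; suff [a ga] : exists a, good s a.
  have at1 : a \in [seq a <- iota 1 t | good s a].
    rewrite mem_filter ga mem_iota; move: ga; rewrite /good /=.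
    by case: ifP => _ /or3P[] //;
      (try case/and3P); move/has_color_bound; lia.
  have : color s \in [seq a <- iota 1 t | good s a].
    by rewrite /color; case: filter at1 => //= b l _; rewrite inE eqxx.
  by rewrite mem_filter => /andP[].
have cs := card_side true sn.
have [big2|small] := ltnP (2 * k) (size s).
  have [|a] := safe_exists t_lt (side_disjoint true sn); first by rewrite cs.
  by exists a; rewrite /good big2 /= orbF.
have [kt|kf] : k <= #|side true s| \/ k <= #|side false s| by move: cs => /=; lia.
  have [A As] := ksubset_exists kt; exists (c A); rewrite /good ltnNge small /=.
  by apply/orP; left; apply/has_colorP; exists A.
have [A As] := ksubset_exists kf; exists (c A); rewrite /good ltnNge small /= orbF.
by apply/orP; right; apply/has_colorP; exists A.
Qed.

Lemma sign_color s : signed_set n s -> 2 * k - 2 < size s ->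
  if 2 * k < size s then safe (side (sign s) s) (side (~~ sign s) s) (color s)
  else has_color (side (sign s) s) (color s).
Proof.
move=> sn big; have /hasP[b _ gb] := good_color sn big.
suff -> : sign s = b by [].
have cb : has_color (side b s) (color s) by move: gb; case: ifP => // _ /andP[].
rewrite /sign leqNgt big /=; case: b cb {gb} => // cb; apply/negbTE.
by apply: has_color_disjoint cb; exact: (side_disjoint false sn).
Qed.

Lemma sign_has_color s : signed_set n s -> 2 * k - 2 < size s ->
  has_color (side (sign s) s) (color s).
Proof. by move=> sn /(sign_color sn); case: ifP => // _ /andP[]. Qed.

Lemma label_negate s : s != [::] -> signed_set n s ->
  label (negate s) = antipode (label s).
Proof.
move=> s0 sn; have mE : magnitude (negate s) = magnitude s.
  by rewrite /magnitude /color (eq_filter (good_negate s)) size_map.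
suff sE : sign (negate s) = ~~ sign s.
  by rewrite /antipode odd_label /label mE sE; case: sign; lia.
rewrite /sign /color (eq_filter (good_negate s)) -/(color s) size_map unzip1_negate {mE}.
case: leqP => [_|big].
  rewrite mem_negate /=; set x := find _ _.
  case/andP: sn => us /allP ltn.
  have xs : x \in unzip1 s.
    have hs : has (mem (unzip1 s)) (iota 0 n).
      case: s s0 ltn {us x} => // y s _ ltn; apply/hasP; exists y.1; rewrite /= ?inE ?eqxx //.
      by rewrite mem_iota /=; apply: ltn; rewrite /= inE eqxx.
    have := nth_find 0 hs; rewrite nth_iota //.
    by rewrite -[X in _ < X](size_iota 0) -has_find.
  have {xs} [b xb] : exists b, (x, b) \in s.
    by case/mapP: xs => -[y b] yb /= ->; exists b.
  apply/idP/negP => [xf xt|xt]; first by have := unzip1_uniq_inj us xf xt.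
  by case: b xb.
have sg : sign s = has_color (side true s) (color s) by rewrite /sign leqNgt big.
have := sign_has_color sn big; rewrite side_negate -sg /=; case: (sign s) sg => // sg _.
apply/negbTE; apply: has_color_disjoint (side_disjoint true sn) _.
by rewrite -sg.
Qed.

(** When both vectors are large, the opposite signs put the color of the prefix on the side of s
    away from the color of s. Properness makes the two colors distinct, and safety of the latter
    makes them non-consecutive. Safety is missing only if s has size at most 2k, which forces the
    sizes 2k - 1 and 2k. *)
Lemma label_gap s i : signed_set n s -> 0 < i < size s ->
  sign (take i s) != sign s ->
  [\/ magnitude (take i s) + 2 <= magnitude s,
      magnitude s + 2 <= magnitude (take i s) |
      [/\ i = 2 * k - 1, size s = 2 * k & magnitude (take i s) != magnitude s]].
Proof.
move=> sn /andP[i0 i_s] sg; set u := take i s in sg *.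
have su : size u = i by rewrite size_takel // ltnW.
have un : signed_set n u by exact: signed_set_take.
have color_gt0 v : signed_set n v -> 2 * k - 2 < size v -> 0 < color v.
  by move=> vn /(sign_has_color vn) /has_color_bound /andP[].
(* Magnitudes of small vectors are even and at most 4k - 4, while a color is at least 1 and gives at
   least 4k - 2. *)
have [small|big] := leqP i (2 * k - 2).
  apply: Or31; rewrite /magnitude su small.
  by have [_|/(color_gt0 _ sn)] := leqP (size s) (2 * k - 2); lia.
have s_big : 2 * k - 2 < size s by exact: ltn_trans i_s.
have mu : magnitude u = 4 * k - 3 + color u by rewrite /magnitude su leqNgt big.
have ms : magnitude s = 4 * k - 3 + color s by rewrite /magnitude leqNgt s_big.
have sub : side (sign u) u \subset side (~~ sign s) s.
  have -> : ~~ sign s = sign u by case: (sign u) (sign s) sg => [] [].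
  exact: side_take.
have cu : has_color (side (~~ sign s) s) (color u).
  by apply: has_color_sub sub _; apply: sign_has_color; rewrite ?su.
have cs := sign_color sn s_big; have cs' := sign_has_color sn s_big.
have neq : color u != color s.
  apply: contraTneq cu => ->; apply: has_color_disjoint cs'; exact: side_disjoint.
rewrite mu ms; case: ltnP cs => [big2|small2] cs.
  case/and3P: cs => _ n1 n2.
  have u1 : color u != (color s).+1 by apply: contraTneq cu => ->.
  have u2 : color u != (color s).-1 by apply: contraTneq cu => ->.
  have [lt|] := ltnP (color u) (color s); [apply: Or31|move=> ge; apply: Or32]; lia.
by apply: Or33; split; lia.
Qed.

Lemma label_prefix s i : signed_set n s -> 0 < i < size s ->
  label (take i s) != antipode (label s).
Proof.
move=> sn i_s; apply/eqP => e.
have sg : sign (take i s) != sign s.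
  by rewrite -!odd_label e /antipode; case: ifP => /=; lia.
have : magnitude (take i s) = magnitude s.
  by rewrite -!label_half e /antipode; case: ifP; lia.
by case: (label_gap sn i_s sg) => [||[_ _ /eqP]]; lia.
Qed.

Lemma color_bound s : signed_set n s -> 2 * k - 2 < size s -> 1 <= color s <= t.
Proof. by move=> sn /(sign_has_color sn) /has_color_bound. Qed.

(** * The lower bound on the number of colors *)

Lemma star_free_colors_lower : 2 * k <= n -> 2 * n - 4 * k + 2 <= t.
Proof.
move=> kn.
have [s [s_n]] := fan_alternating_chain label_perm label_negate label_prefix.
have sn : signed_set n s by apply: (@signed_perms_set n n); rewrite ?mem_signed_perms.
have ss : size s = n by rewrite -(size_map fst) (perm_size s_n) size_iota.
rewrite /sorted_alternating; set l := sort leq _.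
have memL x : x \in l -> exists2 i, 0 < i <= n & x = label (take i s).
  rewrite mem_sort => /mapP[i + ->]; rewrite mem_iota ss => i_n.
  by exists i.+1; first lia.
have sorted_l : sorted leq l by exact: sort_sorted leq_total _.
have size_l : size l = n by rewrite size_sort size_map size_iota.
(* A gap of only 1 can occur just after v, the smaller of the two exceptional labels. *)
set v := minn (label (take (2 * k - 1) s)) (label (take (2 * k) s)).
pose R x y := (x./2 + 2 <= y./2) || ((x == v) && (x./2 < y./2)).
have gap i j : 0 < i < j -> j <= n -> sign (take i s) != sign (take j s) ->
    let x := label (take i s) in let y := label (take j s) in
    [\/ x./2 + 2 <= y./2, y./2 + 2 <= x./2 | minn x y = v /\ x./2 != y./2].
  move=> /andP[i0 ij] jn sg; rewrite /= !label_half.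
  have sj : size (take j s) = j by rewrite size_takel ?ss.
  have uE : take i s = take i (take j s) by rewrite take_takel // ltnW.
  rewrite uE in sg; have := label_gap (signed_set_take j sn) _ sg.
  rewrite -uE sj i0 => /(_ ij) [? | ? | [ei ej ne]]; [exact: Or31 | exact: Or32 | apply: Or33].
  by rewrite /v -ei -ej.
have alt_gap x y : x \in l -> y \in l -> x <= y -> odd x != odd y -> R x y.
  move=> /memL[i i_n ->] /memL[j j_n ->] xy; rewrite !odd_label => sg.
  have hxy := half_leq xy.
  have [ij|ji|e] := ltngtP i j; last by rewrite e eqxx in sg.
    have := gap i j; rewrite sg => /(_ _ _ isT) []; try lia.
    - by rewrite /R => ->.
    - by rewrite (minn_idPl xy) => -[ev ne]; rewrite /R -ev eqxx; lia.
  have := gap j i; rewrite eq_sym sg => /(_ _ _ isT) []; try lia.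
  - by rewrite /R => ->.
  - by rewrite (minn_idPr xy) => -[ev ne]; rewrite /R -ev eqxx; lia.
(* The term [x <= v] is the allowance for the short gap: magnitudes strictly increase along the
   path, so once v is passed it cannot recur. *)
have path_last x r : path R x r -> x./2 + 2 * size r <= (last x r)./2 + (x <= v).
  elim: r x => [|y r IHr] x /=; first lia.
  by case/andP => xy /IHr; move: xy; rewrite /R; case: eqP; lia.
have bound i : 0 < i <= n -> 2 <= magnitude (take i s) <= 4 * k - 3 + t.
  move=> i_n; have := @color_bound (take i s) (signed_set_take i sn).
  rewrite /magnitude size_takel ?ss; last by case/andP: i_n.
  by have [small _|big /(_ isT)] := leqP i (2 * k - 2); lia.
have sorted_R b r : {subset r <= l} -> sorted leq r -> alternating b (map odd r) -> sorted R r.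
  elim: r b => // x [|y r] IHr b // sub /andP[xy yr] /= /andP[/eqP xb /andP[/eqP yb alt]].
  apply/andP; split.
    by apply: alt_gap; rewrite ?sub ?inE ?eqxx ?orbT // xb yb; case: b {xb yb alt}.
  apply: (IHr (~~ b)); rewrite ?yr //= ?yb ?eqxx //.
  by move=> z zr; apply: sub; rewrite inE zr orbT.
move/(sorted_R true l (fun _ => id) sorted_l).
case: l size_l memL {sorted_l sorted_R alt_gap} => [|x r] /=; first lia.
move=> sz memL /path_last.
have [i /bound bi /(congr1 half)] := memL x (mem_head x r).
have [j /bound bj /(congr1 half)] := memL (last x r) (mem_last x r).
(* The n magnitudes start at 2 or more and end at 4k - 3 + t or less, so 2 + 2(n - 1) <= 4k - 3 + t
   + 1. *)
rewrite !label_half => -> ->; case: (_ <= v); lia.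
Qed.

End KneserColoring.

(** * The upper bound by an explicit coloring *)

Section KneserUpper.
Variables (n k : nat).
Hypotheses (k_gt0 : 0 < k) (le_2k_n : 2 * k <= n).
Implicit Types A B : kneser n k.

(* The least element of [A], truncated at [n - 2k + 1]. *)
Definition least A := find (fun x => x \in map val (enum (val A))) (iota 0 (n - 2 * k).+1).

Lemma least_mem A : least A < (n - 2 * k).+1 -> exists2 i, i \in val A & val i = least A.
Proof.
move=> lt; have := lt; rewrite -[X in _ < X](size_iota 0) -has_find.
move/(nth_find 0); rewrite -/(least A) nth_iota // add0n => /mapP[i].
by rewrite mem_enum => iA ->; exists i.
Qed.

Lemma least_le A i : i \in val A -> least A <= i.
Proof.
move=> iA; rewrite leqNgt; apply/negP => lt.
have lt' : i < (n - 2 * k).+1.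
  apply: leq_trans lt _; rewrite /least -[X in _ <= X](size_iota 0); exact: find_size.
have := before_find 0 lt; rewrite nth_iota // add0n => /mapP[]; exists i => //.
by rewrite mem_enum.
Qed.

Lemma least_max A : least A <= (n - 2 * k).+1.
Proof. by rewrite /least -[X in _ <= X](size_iota 0) find_size. Qed.

Lemma card_ge m : #|[set i : 'I_n | m <= i]| = n - m.
Proof.
rewrite cardE -(size_map val) -(size_iota m (n - m)); apply/perm_size/uniq_perm.
- by rewrite (map_inj_uniq val_inj) enum_uniq.
- exact: iota_uniq.
move=> x; rewrite mem_iota; apply/mapP/idP => [[i + ->]|xmn].
  by rewrite mem_enum inE /=; have := ltn_ord i; lia.
have xn : x < n by clear -xmn; lia.
by exists (Ordinal xn); rewrite // mem_enum inE /=; case/andP: xmn.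
Qed.

Lemma adj_disjoint A B i : adj A B -> i \in val A -> i \in val B -> False.
Proof.
by case/andP => _ dAB iA iB; have := disjointFr dAB iA; rewrite iB.
Qed.

Lemma adj_card A B : adj A B -> #|val A :|: val B| = 2 * k.
Proof.
case/andP => _; rewrite -setI_eq0 => /eqP d0.
by rewrite cardsU d0 cards0 (eqP (valP A)) (eqP (valP B)); lia.
Qed.

Lemma adj_subset A B m : m <= least A -> m <= least B ->
  val A :|: val B \subset [set i : 'I_n | m <= i].
Proof.
by move=> mA mB; apply/subsetP => i; rewrite !inE => /orP[] /least_le; exact: leq_trans.
Qed.

(** Below the truncation, equal values give a common element. At the truncation, both sets lie among
    the top 2k - 1 elements, too few for a disjoint union of size 2k. *)
Lemma least_proper A B : adj A B -> least A <> least B.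
Proof.
move=> AB e; have [lt|ge] := ltnP (least A) (n - 2 * k).+1.
  have [i iA vi] := least_mem lt; have [j jB vj] : exists2 j, j \in val B & val j = least B.
    by apply: least_mem; rewrite -e.
  apply: (adj_disjoint AB iA); suff -> : i = j by [].
  by apply: val_inj; rewrite vi vj.
have := subset_leq_card (adj_subset ge (leq_trans ge (eq_leq e))); rewrite adj_card // card_ge; lia.
Qed.

Lemma kneser_colorable : colorable (kneser n k) (n - 2 * k + 2).
Proof.
exists (fun A => (least A).+1); split=> [A B AB [] /(least_proper AB) //|A].
by have := least_max A; lia.
Qed.

Lemma kneser_star_free_colorable : star_free_colorable (kneser n k) (2 * n - 4 * k + 2).
Proof.
(* The colors are 1, 3, ..., 2n - 4k + 1, and the last class is lowered from 2n - 4k + 3 to 2n - 4k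
   + 2. *)
exists (fun A => minn (2 * least A).+1 (2 * n - 4 * k + 2)).
split; last by move=> A; lia.
split=> [A B AB|].
  by have := least_proper AB; have := least_max A; have := least_max B; lia.
(* The only consecutive colors in use are the last two; their classes span the
   k-subsets of the top [2k] elements, where every vertex has a single neighbour. *)
move=> A B C i /and3P[uABC AB BC] E; have pAB := least_proper AB; have pBC := least_proper BC.
have [lA [lB lC]] := (least_max A, (least_max B, least_max C)).
have mem x : (x \in [:: i; i.+1]) = (x == i) || (x == i.+1) by rewrite !inE.
have := E i; have := E i.+1; rewrite !mem !eqxx !orbT !inE => Ei1 /= Ei.
set a := minn _ _ in E Ei1 Ei; set b := minn (2 * least B).+1 _ in E Ei1 Ei.
set e := minn (2 * least C).+1 _ in E Ei1 Ei.
have := E a; have := E b; have := E e; rewrite !mem !inE !eqxx !orbT /= => Ee Eb Ea.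
have topA : n - 2 * k <= least A by lia.
have topB : n - 2 * k <= least B by lia.
have topC : n - 2 * k <= least C by lia.
have cover A' B' : adj A' B' -> n - 2 * k <= least A' -> n - 2 * k <= least B' ->
    val A' :|: val B' = [set i : 'I_n | n - 2 * k <= i].
  move=> AB' tA tB; apply/eqP; rewrite eqEcard adj_subset //= card_ge adj_card //; lia.
(* Both are the complement of B in the top 2k elements. *)
have AC : A = C.
  apply: val_inj; apply/setP => x; have /setP/(_ x) := cover _ _ AB topA topB.
  have /setP/(_ x) := cover _ _ BC topB topC; rewrite !inE => <-.
  case/andP: AB => _ dAB; case/andP: BC => _ dBC.
  have [xB|_] := boolP (x \in val B); last by rewrite orbF.
  by rewrite (disjointFl dAB xB) (disjointFr dBC xB).
by move: uABC; rewrite AC /= !inE eqxx orbT.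
Qed.
End KneserUpper.

(** * The two chromatic numbers *)

(** The new colors 2c - 1 are all odd, so no two of them are consecutive. *)
Lemma colorable_star_free (G : sgraph) t :
  colorable G t -> star_free_colorable G (2 * t - 1).
Proof.
case=> c [cp ct]; exists (fun v => 2 * c v - 1); split; last by move=> v; have := ct v; lia.
split=> [u v uv|u v w i _ E]; first by have := cp u v uv; have := ct u; have := ct v; lia.
have := E i; have := E i.+1; rewrite !inE !eqxx !orbT.
have := ct u; have := ct v; have := ct w.
by do ![case: eqP]; lia.
Qed.

Theorem theorem3 (n k : nat) (n_gt0 : 0 < n) (k_gt0 : 0 < k)
  (le_2k_n : 2 * k <= n) (le_4_2k : 4 <= 2 * k) (le_n_8k3 : 3 * n <= 8 * k) :
  star_free_chromatic_number (kneser n k) = 2 * chromatic_number (kneser n k) - 2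
  /\ 2 * chromatic_number (kneser n k) - 2 = 2 * n - 4 * k + 2.
Proof.
have lower t : star_free_colorable (kneser n k) t -> 2 * n - 4 * k + 2 <= t.
  (* The bound n <= 8k/3 gives 2n - 4k + 2 <= 2k + 2, so only t <= 2k + 1 remains. *)
  case=> c [c_sf c_t]; have [ge|lt] := leqP (2 * k + 2) t; first lia.
  by apply: (star_free_colors_lower _ c_sf c_t); lia.
have -> : chromatic_number (kneser n k) = n - 2 * k + 2.
  rewrite /chromatic_number; case: ex_minnP => t /asboolP ct tmin.
  (* By parity, 2t - 1 >= 2n - 4k + 2 improves to t >= n - 2k + 2. *)
  have := lower _ (colorable_star_free ct).
  by have := tmin _ (asboolT (kneser_colorable k_gt0 le_2k_n)); lia.
split; last lia.
rewrite /star_free_chromatic_number; case: ex_minnP => t /asboolP[t0 ct] tmin.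
have := lower _ ct.
have up : 0 < 2 * n - 4 * k + 2 /\ star_free_colorable (kneser n k) (2 * n - 4 * k + 2).
  by split; [lia|exact: kneser_star_free_colorable].
by have := tmin _ (asboolT up); lia.
Qed.
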